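(* For every $n\ge 1$, the map $\varphi:\mathcal{M}_n\to\mathcal{CK}_n$, from the lattice $\mathcal{M}_n$ of painted trees with $n$ leaves to the lattice $\mathcal{CK}_n$ of weighted trees with weights summing to $n$, which replaces the unpainted forest of a painted tree by a forest of corollas, is an interval retract.
   Context: Binary trees. A planar rooted binary tree (binary tree) with $m$ internal nodes has $m+1$ leaves; $\mathcal{Y}_m$ denotes the set of these. Internal nodes are numbered $1,\dots,m$ from left to right (in-order: node $i$ separates the $i$-th leaf from the $(i+1)$-st leaf), and are also partially ordered by proximity to the root, the root being maximal (the node poset). An upper order ideal of the node poset is a subset containing, with any node, all nodes on the path from it to the root. $\mathcal{Y}_m$ carries the Tamari order: the partial order generated by replacing a subtree $((a\,b)\,c)$ by $(a\,(b\,c))$, the latter being larger; left combs are minimal and right combs maximal. Painted trees. A painted tree $p=(t;P)$ is a binary tree $t$ with a (possibly empty) upper order ideal $P$ of its node poset, the painted nodes. Its painted portion is the binary tree formed by the painted nodes, with $k=|P|+1$ leaves (a single edge if $P=\emptyset$); the parts of $t$ above these $k$ leaves form the ordered unpainted forest $(f_1,\dots,f_k)$ of binary trees (some possibly a single leaf with no nodes), listed left to right. $\mathcal{M}_n$ denotes the set of painted trees with $n$ leaves (i.e. $n-1$ internal nodes), with order $(s;S)\le(t;T)$ if $s\le t$ in the Tamari order on $\mathcal{Y}_{n-1}$ and $T\subseteq S$ as subsets of $\{1,\dots,n-1\}$. It is a finite lattice. (Under the bijection from bi-leveled trees with $n$ nodes to painted trees with $n-1$ nodes which removes the leftmost branch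 and node, this is the order on bi-leveled trees.) Weighted trees. A weighted tree is a (painted) binary tree with a corolla (a rooted tree with one interior node) grafted to each leaf; each corolla is equivalently recorded as a positive integer weight, its number of leaves, or as the right comb with that number of leaves (weight $1$ meaning a single leaf). $\mathcal{CK}_n$ is the set of weighted trees whose weights sum to $n$. Using right combs for the corollas, $\mathcal{CK}_n$ is identified with the set of painted trees in $\mathcal{M}_n$ all of whose unpainted trees $f_i$ are right combs, and it is given the same order relation as in $\mathcal{M}_n$ (restricted to this subset). The map. $\varphi$ keeps the painted portion of $p$ and replaces each unpainted tree $f_i$ by the corolla (equivalently the right comb) with the same number of leaves. Interval retract. An interval of a poset is a sub-poset $[a,b]=\{x\mid a\le x\le b\}$. A surjective poset map (order-preserving map) $f:P\to Q$ from a finite lattice $P$ is an interval retract if the fibers of $f$ are intervals and $f$ admits an order-preserving section $g:Q\to P$ with $f\circ g=\mathrm{id}$. *)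

(* Defs.v *)
From HB Require Import structures.
From mathcomp Require Import all_boot all_order.
From mathcomp Require Import zify.

Set Implicit Arguments.
Unset Strict Implicit.
Unset Printing Implicit Defensive.

Import Order.TTheory.
Local Open Scope order_scope.

Inductive bintree : Type := Leaf | Node of bintree & bintree.

Fixpoint bintree_encode (t : bintree) : GenTree.tree unit :=
  if t is Node l r then GenTree.Node 0 [:: bintree_encode l; bintree_encode r]
  else GenTree.Leaf tt.

Fixpoint bintree_decode (c : GenTree.tree unit) : bintree :=
  if c is GenTree.Node _ [:: l; r]
  then Node (bintree_decode l) (bintree_decode r) else Leaf.

Lemma bintree_encodeK : cancel bintree_encode bintree_decode.
Proof. by elim=> //= l -> r ->. Qed.

HB.instance Definition _ := Countable.copy bintree (can_type bintree_encodeK).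

Fixpoint nodes (t : bintree) : nat :=
  if t is Node l r then (nodes l + nodes r).+1 else 0.

Fixpoint leaves (t : bintree) : nat :=
  if t is Node l r then leaves l + leaves r else 1.

Lemma leavesE t : leaves t = (nodes t).+1.
Proof. elim: t => //= l -> r ->; lia. Qed.

Lemma leaves_gt0 t : 0 < leaves t.
Proof. by rewrite leavesE. Qed.

(* Nodes are numbered from left to right starting at 0, so the node i of the
   mathematical numbering 1, ..., m is i - 1 here. [node_le t i j] means that
   j is on the path from i to the root of t (i = j included). *)
Fixpoint node_le (t : bintree) (i j : nat) : bool :=
  if t is Node l r then
    let k := nodes l in
    [|| (j == k) && (i < nodes t)%N,
        [&& (i < k)%N, (j < k)%N & node_le l i j]
      | [&& (k < i)%N, (k < j)%N & node_le r (i - k.+1) (j - k.+1)]]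
  else false.

(* t is obtained from s by replacing one subtree ((a b) c) by (a (b c)) *)
Fixpoint rotation (s t : bintree) : bool :=
  match s, t with
  | Node sl sr, Node tl tr =>
      [|| (if sl is Node a b then (tl == a) && (tr == Node b sr) else false),
          rotation sl tl && (sr == tr)
        | (sl == tl) && rotation sr tr]
  | _, _ => false
  end.

Record tree (m : nat) := Tree {tree_val :> bintree; _ : nodes tree_val == m}.

HB.instance Definition _ m := [isSub for @tree_val m].
HB.instance Definition _ m := [Countable of tree m by <:].

Fixpoint trees_upto (h : nat) : seq bintree :=
  if h is h'.+1 then
    Leaf :: [seq Node l r | l <- trees_upto h', r <- trees_upto h']
  else [:: Leaf].

Lemma mem_trees_upto h t : (nodes t <= h)%N -> t \in trees_upto h.
Proof.
elim: h t => [|h IH] [|l r] //= lrh.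
rewrite in_cons; apply/orP; right.
by apply: allpairs_f; apply: IH; lia.
Qed.

Definition tree_enum m : seq (tree m) := undup (pmap insub (trees_upto m)).

Lemma tree_enumP m : Finite.axiom (tree_enum m).
Proof.
apply: Finite.uniq_enumP; first exact: undup_uniq.
move=> t; rewrite mem_undup mem_pmap_sub inE mem_trees_upto //.
by case: t => t /= /eqP->.
Qed.

HB.instance Definition _ m := isFinite.Build (tree m) (@tree_enumP m).

Fact tree_display : Order.disp_t. Proof. exact: Order.Disp tt tt. Qed.

Definition rotation_rel m : rel (tree m) := fun s t => rotation s t.
Definition tamari m : rel (tree m) := connect (@rotation_rel m).
Arguments tamari {m} s t.

Fixpoint right_sizes (t : bintree) : nat :=
  if t is Node l r then right_sizes l + right_sizes r + nodes r else 0.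

Lemma rotation_nodes s t : rotation s t -> nodes s = nodes t.
Proof.
elim: s t => [|l IHl r IHr] [|l' r'] //= /or3P[].
- by case: l {IHl} => // a b /andP[/eqP-> /eqP->] /=; lia.
- by move=> /andP[/IHl-> /eqP->].
- by move=> /andP[/eqP-> /IHr->].
Qed.

Lemma rotation_right_sizes s t :
  rotation s t -> (right_sizes s < right_sizes t)%N.
Proof.
elim: s t => [|l IHl r IHr] [|l' r'] //= /or3P[].
- by case: l {IHl} => // a b /andP[/eqP-> /eqP->] /=; lia.
- by move=> /andP[/IHl ? /eqP->]; lia.
- by move=> /andP[/eqP-> /[dup] /rotation_nodes-> /IHr ?]; lia.
Qed.

Lemma tamari_refl m : reflexive (@tamari m).
Proof. by move=> t; exact: connect0. Qed.

Lemma tamari_trans m : transitive (@tamari m).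
Proof. by move=> t s u; exact: connect_trans. Qed.

Lemma tamari_right_sizes m (s t : tree m) :
  tamari s t -> s = t \/ (right_sizes s < right_sizes t)%N.
Proof.
move=> /connectP[p + ->]; elim: p s => [|u p IH] s /=; first by left.
move=> /andP[/rotation_right_sizes su /IH[<-|up]]; right => //.
exact: ltn_trans up.
Qed.

Lemma tamari_anti m : antisymmetric (@tamari m).
Proof.
move=> s t /andP[/tamari_right_sizes[-> //|st]].
by move=> /tamari_right_sizes[-> //|ts]; lia.
Qed.

HB.instance Definition _ m := Order.Le_isPOrder.Build tree_display (tree m)
  (@tamari_refl m) (@tamari_anti m) (@tamari_trans m).

Definition upper_ideal m (t : bintree) (P : {set 'I_m}) : bool :=
  [forall i in P, forall j : 'I_m, node_le t i j ==> (j \in P)].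

(* For n = 0 this type is inhabited by the tree with one leaf; it is only
   meaningful for n >= 1. *)
Record painted (n : nat) := Painted {
  painted_val : tree n.-1 * {set 'I_n.-1};
  _ : upper_ideal painted_val.1 painted_val.2 }.

HB.instance Definition _ n := [isSub for @painted_val n].
HB.instance Definition _ n := [Finite of painted n by <:].

Definition ptree n (p : painted n) : tree n.-1 := (painted_val p).1.
Definition pset n (p : painted n) : {set 'I_n.-1} := (painted_val p).2.

Definition painted_le n (p q : painted n) : bool :=
  (ptree p <= ptree q) && (pset q \subset pset p).

Lemma painted_le_refl n : reflexive (@painted_le n).
Proof. by move=> p; rewrite /painted_le lexx subxx. Qed.

Lemma painted_le_anti n : antisymmetric (@painted_le n).
Proof.
move=> p q /andP[/andP[pq QP] /andP[qp PQ]].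
apply: val_inj; move: pq qp QP PQ; rewrite /ptree /pset /=.
case: (painted_val p) (painted_val q) => [s S] [t T] /= st ts TS ST.
by congr (_, _); [apply/le_anti; rewrite st | apply/eqP; rewrite eqEsubset ST].
Qed.

Lemma painted_le_trans n : transitive (@painted_le n).
Proof.
move=> q p r /andP[pq QP] /andP[qr RQ].
by rewrite /painted_le (le_trans pq qr) (subset_trans RQ QP).
Qed.

HB.instance Definition _ n := Order.Le_isPOrder.Build tree_display (painted n)
  (@painted_le_refl n) (@painted_le_anti n) (@painted_le_trans n).

(* P is the set of the numbers of the painted nodes; as it is an upper order
   ideal, the subtree above an unpainted node has no painted node. *)
Fixpoint portion (t : bintree) (P : pred nat) : bintree :=
  if t is Node l r then
    if P (nodes l) then Node (portion l P) (portion r (fun i => P ((nodes l).+1 + i)))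
    else Leaf
  else Leaf.

Fixpoint forest (t : bintree) (P : pred nat) : seq bintree :=
  if t is Node l r then
    if P (nodes l) then forest l P ++ forest r (fun i => P ((nodes l).+1 + i))
    else [:: t]
  else [:: Leaf].

Definition is_painted n (p : painted n) : pred nat :=
  fun i => [exists j in pset p, val j == i].

Definition painted_portion n (p : painted n) : bintree :=
  portion (ptree p) (is_painted p).

Definition unpainted_forest n (p : painted n) : seq bintree :=
  forest (ptree p) (is_painted p).

Lemma size_forest t P : size (forest t P) = leaves (portion t P).
Proof.
elim: t P => //= l IHl r IHr P; case: ifP => // _.
by rewrite size_cat IHl IHr.
Qed.

Lemma sumn_leaves_forest t P : sumn (map leaves (forest t P)) = leaves t.
Proof.
elim: t P => //= l IHl r IHr P; case: ifP => _; last by rewrite /= addn0.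
by rewrite map_cat sumn_cat IHl IHr.
Qed.

(* Weighted trees: a binary tree with the weights of the corollas grafted to
   its leaves, listed from left to right *)

Definition is_weighted (n : nat) (c : bintree * seq nat) : bool :=
  [&& size c.2 == leaves c.1, all (fun w => 0 < w)%N c.2 & sumn c.2 == n].

Record weighted (n : nat) := Weighted {
  weighted_val : bintree * seq nat; _ : is_weighted n weighted_val }.

HB.instance Definition _ n := [isSub for @weighted_val n].
HB.instance Definition _ n := [Countable of weighted n by <:].

Fixpoint graft (t : bintree) (fs : seq bintree) : bintree :=
  if t is Node l r then
    Node (graft l (take (leaves l) fs)) (graft r (drop (leaves l) fs))
  else head Leaf fs.

Definition right_comb (w : nat) : bintree := iter w.-1 (Node Leaf) Leaf.

Lemma leaves_right_comb w : (0 < w)%N -> leaves (right_comb w) = w.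
Proof. by case: w => //= w _; elim: w => //= w ->. Qed.

(* w_1, w_1 + w_2, ..., w_1 + ... + w_{k-1} where w = (w_1, ..., w_k). After
   the combs are grafted, the j-th node of the painted portion separates the
   leaves w_1 + ... + w_j and w_1 + ... + w_j + 1, so these are the numbers
   (counted from 1) of the painted nodes. *)
Definition cuts (w : seq nat) : seq nat :=
  [seq sumn (take j w) | j <- iota 1 (size w).-1].

Definition comb_graft (c : bintree * seq nat) : bintree :=
  graft c.1 (map right_comb c.2).

Definition comb_paint (n : nat) (c : bintree * seq nat) : {set 'I_n.-1} :=
  [set i : 'I_n.-1 | i.+1 \in cuts c.2].

Lemma cutsP w j :
  reflect (exists2 i, (0 < i < size w)%N & j = sumn (take i w)) (j \in cuts w).
Proof.
apply: (iffP mapP) => -[i iw ->]; exists i => //.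
  by move: iw; rewrite mem_iota; lia.
by rewrite mem_iota; lia.
Qed.

Lemma sumn_pos w : all (fun w => 0 < w)%N w -> (size w <= sumn w)%N.
Proof. by elim: w => //= x w IH /andP[? /IH]; lia. Qed.

Lemma cuts_lt w j : all (fun w => 0 < w)%N w -> j \in cuts w ->
  (0 < j < sumn w)%N.
Proof.
move=> w0 /cutsP[i iw ->].
rewrite -{3}(cat_take_drop i w) sumn_cat.
move: w0; rewrite -{1}(cat_take_drop i w) all_cat => /andP[].
move=> /sumn_pos + /sumn_pos; rewrite size_takel ?size_drop; lia.
Qed.

Lemma cuts_cat (u v : seq nat) (j : nat) : u != [::] -> v != [::] ->
  all (fun w => 0 < w)%N u -> all (fun w => 0 < w)%N v ->
  (j \in cuts (u ++ v)) =
  [|| j \in cuts u, j == sumn u | (sumn u < j)%N && (j - sumn u \in cuts v)].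
Proof.
move=> un vn u0 v0.
have su : (0 < size u)%N by case: (u) un.
have sv : (0 < size v)%N by case: (v) vn.
apply/cutsP/or3P.
- case=> i; rewrite size_cat take_cat => ilt ->.
  case: ltnP => iu; first by apply: Or31; apply/cutsP; exists i => //; lia.
  rewrite sumn_cat; have [iE|ine] := eqVneq i (size u).
    by apply: Or32; rewrite iE subnn take0 addn0.
  have ic : sumn (take (i - size u) v) \in cuts v.
    by apply/cutsP; exists (i - size u)%N => //; lia.
  apply: Or33; rewrite addKn ic andbT.
  by have /andP[c0 _] := cuts_lt v0 ic; rewrite -[ltnLHS]addn0 ltn_add2l.
- case=> [/cutsP[i iu ->]|/eqP->|/andP[uj /cutsP[i iv jE]]].
  + by exists i; rewrite ?size_cat ?take_cat; [lia|case: ifP => //; lia].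
  + exists (size u); rewrite ?size_cat ?take_size_cat //; lia.
  + exists (size u + i)%N; rewrite ?size_cat ?take_cat; first lia.
    rewrite ifF; last lia.
    by rewrite sumn_cat addKn -jE; lia.
Qed.

Lemma leaves_comb_graft t w : size w = leaves t ->
  all (fun w => 0 < w)%N w -> leaves (comb_graft (t, w)) = sumn w.
Proof.
rewrite /comb_graft /=; elim: t w => [|l IHl r IHr] w /=.
  by case: w => [|x []] //= _ /andP[x0 _]; rewrite leaves_right_comb ?addn0.
move=> sw w0; have := w0; rewrite -{1}(cat_take_drop (leaves l) w) all_cat.
move=> /andP[u0 v0]; rewrite -map_take -map_drop IHl ?IHr //.
- by rewrite -sumn_cat cat_take_drop.
- by rewrite size_drop; lia.
- by rewrite size_takel // sw leq_addr.
Qed.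

Lemma split_weights l r w : size w = leaves (Node l r) ->
  all (fun w => 0 < w)%N w ->
  exists u v, [/\ w = u ++ v, size u = leaves l, size v = leaves r,
    all (fun w => 0 < w)%N u & all (fun w => 0 < w)%N v].
Proof.
move=> /= sw; rewrite -{1}(cat_take_drop (leaves l) w) all_cat => /andP[u0 v0].
exists (take (leaves l) w), (drop (leaves l) w).
rewrite cat_take_drop size_drop size_takel ?sw ?leq_addr // addKn.
by split.
Qed.

Lemma comb_graft_node l r u v : size u = leaves l ->
  comb_graft (Node l r, u ++ v) = Node (comb_graft (l, u)) (comb_graft (r, v)).
Proof.
by move=> su; rewrite /comb_graft /= map_cat take_size_cat ?drop_size_cat ?size_map.
Qed.

Lemma size_leaves_neq0 t (w : seq nat) : size w = leaves t -> w != [::].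
Proof. by move=> sw; rewrite -size_eq0 sw leavesE. Qed.

Lemma nodes_comb_graft t w : size w = leaves t ->
  all (fun w => 0 < w)%N w -> (nodes (comb_graft (t, w))).+1 = sumn w.
Proof. by move=> sw w0; rewrite -leavesE leaves_comb_graft. Qed.

Lemma comb_graft_upper t w i j : size w = leaves t ->
  all (fun w => 0 < w)%N w -> node_le (comb_graft (t, w)) i j ->
  i.+1 \in cuts w -> j.+1 \in cuts w.
Proof.
elim: t w i j => [|l IHl r IHr] w i j.
  by case: w => [|x []].
move=> sw w0; have [u [v [-> su sv u0 v0]]] := split_weights sw w0.
have ne := cuts_cat _ (size_leaves_neq0 su) (size_leaves_neq0 sv) u0 v0.
rewrite comb_graft_node // !ne /=.
have ku := nodes_comb_graft su u0.
set k := nodes _ in ku *.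
move=> /or3P[/andP[/eqP-> _] _|/and3P[ik jk lij]|/and3P[ki kj rij]].
- by rewrite ku eqxx orbT.
- move=> /or3P[iu|/eqP|/andP[+ _]]; try lia.
  by rewrite (IHl u i j).
- move=> /or3P[/(cuts_lt u0)|/eqP|/andP[ui iv]]; try lia.
  apply/or3P; apply: Or33; rewrite -ku ltnS kj /=.
  have -> : (j.+1 - k.+1 = (j - k.+1).+1)%N by lia.
  apply: (IHr v (i - k.+1)%N) => //.
  by have <- : (i.+1 - sumn u = (i - k.+1).+1)%N by lia.
Qed.

Lemma eq_portion t (P Q : pred nat) :
  (forall i, (i < nodes t)%N -> P i = Q i) -> portion t P = portion t Q.
Proof.
elim: t P Q => //= l IHl r IHr P Q PQ; rewrite PQ ?ltnS ?leq_addr //.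
case: ifP => // _; congr Node; first by apply: IHl => i il; apply: PQ; lia.
by apply: IHr => i ir; apply: PQ; lia.
Qed.

Lemma eq_forest t (P Q : pred nat) :
  (forall i, (i < nodes t)%N -> P i = Q i) -> forest t P = forest t Q.
Proof.
elim: t P Q => //= l IHl r IHr P Q PQ; rewrite PQ ?ltnS ?leq_addr //.
case: ifP => // _; congr cat; first by apply: IHl => i il; apply: PQ; lia.
by apply: IHr => i ir; apply: PQ; lia.
Qed.

Lemma comb_graft_decomp t w (P := fun i => i.+1 \in cuts w) :
  size w = leaves t -> all (fun w => 0 < w)%N w ->
  portion (comb_graft (t, w)) P = t /\
  forest (comb_graft (t, w)) P = map right_comb w.
Proof.
rewrite {}/P; elim: t w => [|l IHl r IHr] w.
  by case: w => [|x []] // _ _; rewrite /comb_graft /=; case: (right_comb x).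
move=> sw w0; have [u [v [-> su sv u0 v0]]] := split_weights sw w0.
have ne := cuts_cat _ (size_leaves_neq0 su) (size_leaves_neq0 sv) u0 v0.
rewrite comb_graft_node //=; have ku := nodes_comb_graft su u0.
rewrite ku ne eqxx orbT map_cat.
have [pl fl] := IHl u su u0; have [pr fr] := IHr v sv v0.
have eql i : (i < nodes (comb_graft (l, u)))%N ->
    (i.+1 \in cuts (u ++ v)) = (i.+1 \in cuts u).
  move=> il; rewrite ne; have -> : (i.+1 == sumn u) = false by lia.
  have -> : (sumn u < i.+1)%N = false by lia.
  by rewrite !orbF.
have eqr i : (i < nodes (comb_graft (r, v)))%N ->
    ((sumn u + i).+1 \in cuts (u ++ v)) = (i.+1 \in cuts v).
  move=> ir; rewrite ne.
  have -> : ((sumn u + i).+1 \in cuts u) = false.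
    by apply/negP => /(cuts_lt u0); lia.
  have -> : ((sumn u + i).+1 == sumn u) = false by lia.
  have -> : (sumn u < (sumn u + i).+1)%N by lia.
  by have -> : ((sumn u + i).+1 - sumn u = i.+1)%N by lia.
split; first by rewrite (eq_portion eql) pl (eq_portion eqr) pr.
by rewrite (eq_forest eql) fl (eq_forest eqr) fr.
Qed.

Section Comb.
Variables (n : nat) (q : weighted n).

Lemma weighted_nodes : nodes (comb_graft (weighted_val q)) == n.-1.
Proof.
case: q => -[t w] /= /and3P[/= /eqP sw w0 /eqP <-].
by rewrite -(nodes_comb_graft sw w0).
Qed.

Lemma weighted_upper :
  upper_ideal (Tree weighted_nodes) (comb_paint n (weighted_val q)).
Proof.
apply/forall_inP => i; rewrite inE => iP; apply/forallP => j.
apply/implyP; rewrite inE /=; move: iP.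
case: q => -[t w] /= /and3P[/= /eqP sw w0 _] iP ij.
exact: comb_graft_upper ij iP.
Qed.

(* The painted tree in which each corolla is replaced by a right comb. *)
Definition comb_painted : painted n :=
  @Painted n (Tree weighted_nodes, comb_paint n (weighted_val q)) weighted_upper.

Lemma is_painted_comb i : (i < n.-1)%N ->
  is_painted comb_painted i = (i.+1 \in cuts (weighted_val q).2).
Proof.
move=> ilt; apply/exists_inP/idP => [[j]|iP].
  by rewrite inE => + /eqP <-.
by exists (Ordinal ilt); rewrite ?inE.
Qed.

Lemma painted_portion_comb :
  painted_portion comb_painted = (weighted_val q).1.
Proof.
rewrite /painted_portion (@eq_portion _ _ (fun i => i.+1 \in cuts (weighted_val q).2)).
  rewrite -[tree_val _]/(comb_graft (weighted_val q)).
  case: q => -[t w] /= /and3P[/= /eqP sw w0 _].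
  exact: (comb_graft_decomp sw w0).1.
by move=> i; rewrite /= (eqP weighted_nodes); exact: is_painted_comb.
Qed.

Lemma unpainted_forest_comb :
  unpainted_forest comb_painted = map right_comb (weighted_val q).2.
Proof.
rewrite /unpainted_forest (@eq_forest _ _ (fun i => i.+1 \in cuts (weighted_val q).2)).
  rewrite -[tree_val _]/(comb_graft (weighted_val q)).
  case: q => -[t w] /= /and3P[/= /eqP sw w0 _].
  exact: (comb_graft_decomp sw w0).2.
by move=> i; rewrite /= (eqP weighted_nodes); exact: is_painted_comb.
Qed.

Lemma weights_comb :
  map leaves (unpainted_forest comb_painted) = (weighted_val q).2.
Proof.
rewrite unpainted_forest_comb -map_comp; case: q => -[t w] /= /and3P[_ /= w0 _].
elim: w w0 => //= x w IH /andP[x0 /IH->].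
by rewrite leaves_right_comb.
Qed.

End Comb.

Lemma comb_painted_inj n : injective (@comb_painted n).
Proof.
move=> q q' e; apply: val_inj => /=.
rewrite [LHS]surjective_pairing [RHS]surjective_pairing.
by rewrite -!painted_portion_comb -!weights_comb e.
Qed.

Definition weighted_le n (q q' : weighted n) : bool :=
  comb_painted q <= comb_painted q'.

Lemma weighted_le_refl n : reflexive (@weighted_le n).
Proof. by move=> q; exact: lexx. Qed.

Lemma weighted_le_anti n : antisymmetric (@weighted_le n).
Proof. by move=> q q' /le_anti /comb_painted_inj. Qed.

Lemma weighted_le_trans n : transitive (@weighted_le n).
Proof. by move=> q p r; exact: le_trans. Qed.

HB.instance Definition _ n := Order.Le_isPOrder.Build tree_display (weighted n)
  (@weighted_le_refl n) (@weighted_le_anti n) (@weighted_le_trans n).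

Lemma phi_subproof n (hn : (1 <= n)%N) (p : painted n) :
  is_weighted n (painted_portion p, map leaves (unpainted_forest p)).
Proof.
apply/and3P; split => /=.
- by rewrite size_map size_forest.
- by apply/allP => w /mapP[f _ ->]; exact: leaves_gt0.
- rewrite sumn_leaves_forest leavesE; case: (ptree p) => t /= /eqP->.
  by rewrite prednK.
Qed.

Definition phi n (hn : (1 <= n)%N) (p : painted n) : weighted n :=
  Weighted (phi_subproof hn p).

Definition is_lattice d (T : porderType d) : Prop :=
  forall x y : T,
    (exists m : T, [/\ m <= x, m <= y &
       forall z : T, z <= x -> z <= y -> z <= m]) /\
    (exists j : T, [/\ x <= j, y <= j &
       forall z : T, x <= z -> y <= z -> j <= z]).

Definition interval_retract d d' (P : finPOrderType d) (Q : porderType d')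
    (f : P -> Q) : Prop :=
  [/\ is_lattice P,
      {homo f : x y / x <= y},
      (forall q : Q, exists p : P, f p = q),
      (forall q : Q, exists a b : P, forall x : P, f x = q <-> a <= x <= b) &
      exists g : Q -> P, {homo g : x y / x <= y} /\ cancel g f].

(* Main.v *)
Require Import Defs.
From mathcomp Require Import all_boot all_order.
From mathcomp Require Import zify.
From Stdlib Require Import Relation_Operators.

(** Everything is read off the bracket vector of a tree, which records for
    each node the size of its right subtree.  Bracket vectors are the vectors
    whose intervals [i, i + v i] are nested, and the Tamari order is their
    pointwise order: a rotation enlarges one entry, and conversely a pointwise
    comparison is turned into rotations by bringing the root of the larger
    tree, which lies on the left spine of the smaller one, to the root
    ([spine_to_root], [bracket_rotations]).  A node j is an ancestor of i
    either because i lies in the interval of j, or because i < j and no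
    interval starting in [i, j) reaches j ([node_leP]); so the node poset is
    also determined by the vector.

    Painted trees form a lattice because there is a top, the unpainted right
    comb, and because two painted trees have a meet.  Its bracket vector v is
    the pointwise minimum, and its painted set is the upward closure in v of
    the union of the two painted sets.  This closure only adds nodes j to the
    right of some i with no interval of v from [i, j) reaching j: if i lies in
    the interval of j in v, it does so in both trees, and j was painted
    already.  The condition on the added nodes survives shrinking v, so every
    lower bound paints them too ([painted_meet]).

    The map p |-> comb_painted (phi p) keeps the painted set and the entries of
    painted nodes, and stretches the interval of an unpainted node up to the
    next painted node ([combedP]).  Hence it is extensive, and it is monotone
    even if brackets are compared at painted nodes only ([phi_le]).  Two
    consequences follow.  First, the right comb grafting is a monotone section
    of phi, so weighted trees inherit the lattice property from painted trees.
    Secondly, a fibre of phi consists of the painted trees with given painted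
    set and given entries at the painted nodes.  Its largest element is the
    grafting of right combs, and its smallest element, with left combs, has
    entry 0 at every unpainted node ([fibre_bottom], [phi_fibre]). *)

Set Implicit Arguments.
Unset Strict Implicit.
Unset Printing Implicit Defensive.

Import Order.TTheory.

(** * Bracket vectors *)

Fixpoint bracket (t : bintree) (i : nat) : nat :=
  if t is Node l r then
    if i < nodes l then bracket l i
    else if i == nodes l then nodes r else bracket r (i - (nodes l).+1)
  else 0.

Lemma bracket_l l r i : i < nodes l -> bracket (Node l r) i = bracket l i.
Proof. by rewrite /= => ->. Qed.

Lemma bracket_root l r : bracket (Node l r) (nodes l) = nodes r.
Proof. by rewrite /= ltnn eqxx. Qed.

Lemma bracket_r l r i : bracket (Node l r) ((nodes l).+1 + i) = bracket r i.
Proof.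
rewrite /= ifF; last lia.
by rewrite ifF; [rewrite addKn | lia].
Qed.

Variant node_spec (l r : bintree) : nat -> Prop :=
  | NodeL i of i < nodes l : node_spec l r i
  | NodeRoot : node_spec l r (nodes l)
  | NodeR i of i < nodes r : node_spec l r ((nodes l).+1 + i).

Lemma nodeP l r i : i < nodes (Node l r) -> node_spec l r i.
Proof.
move=> /= im; case: (ltngtP i (nodes l)) => [il|li|->]; try by constructor.
have -> : i = (nodes l).+1 + (i - (nodes l).+1) by lia.
by constructor; lia.
Qed.

(** The intervals [i, i + v i] lie in [0, m) and are nested or disjoint. *)
Definition is_bracket (m : nat) (v : nat -> nat) : Prop :=
  forall i, i < m ->
    i + v i < m /\ forall j, i <= j <= i + v i -> j + v j <= i + v i.

Lemma bracket_lt t i : i < nodes t -> i + bracket t i < nodes t.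
Proof.
elim: t i => // l IHl r IHr i /nodeP[{}i il||{}i ir].
- by rewrite bracket_l //=; have := IHl i il; lia.
- by rewrite bracket_root /=; lia.
- by rewrite bracket_r /=; have := IHr i ir; lia.
Qed.

Lemma bracketP t : is_bracket (nodes t) (bracket t).
Proof.
move=> i im; split; first exact: bracket_lt.
elim: t i im => // l IHl r IHr i /nodeP[{}i il||{}i ir] j.
- rewrite bracket_l // => ij; have il' := bracket_lt il.
  by rewrite bracket_l; [exact: IHl | lia].
- rewrite bracket_root => jr; have jm : j < nodes (Node l r) by move=> /=; lia.
  by have /= := bracket_lt jm; lia.
- rewrite bracket_r => ij.
  have -> : j = (nodes l).+1 + (j - (nodes l).+1) by lia.
  rewrite bracket_r.
  by have := IHr i ir (j - (nodes l).+1); lia.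
Qed.

(** The root is recovered as the first node whose interval reaches the last
    node; minimality keeps the intervals of the nodes to its left off it. *)
Lemma bracket_realize m v : is_bracket m v ->
  exists t, nodes t = m /\ forall i, i < m -> bracket t i = v i.
Proof.
elim/ltn_ind: m v => -[|m] IH v vP; first by exists Leaf.
have exk : exists k, k + v k == m.
  by exists m; have [+ _] := vP m (leqnn _); lia.
case: (ex_minnP exk) => k /eqP kE kmin.
have left_lt i : i < k -> i + v i < k.
  move=> ik; have [im nest] : _ /\ _ := vP i ltac:(lia).
  rewrite ltnNge; apply/negP => ki.
  have := nest k ltac:(lia); move=> ki'.
  by have := kmin i ltac:(lia); lia.
have [l [lE lv]] : exists t, nodes t = k /\ forall i, i < k -> bracket t i = v i.
  apply: IH; first lia.
  by move=> i ik; split; [exact: left_lt | case: (vP i ltac:(lia))].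
have [r [rE rv]] : exists t, nodes t = m - k /\
    forall i, i < m - k -> bracket t i = v (k.+1 + i).
  apply: (IH (m - k) ltac:(lia) (fun i => v (k.+1 + i))) => i im.
  have [im' nest] := vP (k.+1 + i) ltac:(lia).
  by split=> [|j ij]; [|have := nest (k.+1 + j) ltac:(lia)]; lia.
exists (Node l r); split=> [|i im]; first by rewrite /=; lia.
have /nodeP iP : i < nodes (Node l r) by rewrite /=; lia.
case: iP im => [{}i il||{}i ir] im.
- by rewrite bracket_l // lv // -lE.
- by rewrite bracket_root lE; lia.
- by rewrite bracket_r rv ?lE //; lia.
Qed.

(** * The Tamari order is the pointwise order of bracket vectors *)

Lemma rotation_bracket s t i : rotation s t -> bracket s i <= bracket t i.
Proof.
elim: s t i => [|l IHl r IHr] [|l' r'] //= i /or3P[].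
- case: l {IHl} => // a b /andP[/eqP-> /eqP->] /=.
  case: (ltngtP i (nodes a)) => [ia|ai|ia].
  + by rewrite ifT //; lia.
  + rewrite (_ : (i < _.+1) = (i - (nodes a).+1 < nodes b)); last lia.
    rewrite (_ : (i == _.+1) = (i - (nodes a).+1 == nodes b)); last lia.
    case: ifP => // _; case: ifP => // _.
    by rewrite (_ : i - _ = i - (nodes a).+1 - (nodes b).+1) //; lia.
  + by rewrite ifT; lia.
- move=> /andP[ll' /eqP->]; rewrite (rotation_nodes ll').
  by case: ifP => // _; exact: IHl.
- move=> /andP[/eqP-> rr']; rewrite (rotation_nodes rr').
  by case: ifP => // _; case: ifP => // _; exact: IHr.
Qed.

Notation rotations := (clos_refl_trans bintree rotation).

Lemma rotations_node l l' r r' :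
  rotations l l' -> rotations r r' -> rotations (Node l r) (Node l' r').
Proof.
move=> ll' rr'; apply: (@rt_trans _ _ _ (Node l' r)).
- elim: ll' => [a b ab|a|a b c _ ab _ bc].
  + by apply: rt_step; rewrite /= ab eqxx orbT.
  + exact: rt_refl.
  + exact: rt_trans ab bc.
- elim: rr' => [a b ab|a|a b c _ ab _ bc].
  + by apply: rt_step; rewrite /= ab eqxx !orbT.
  + exact: rt_refl.
  + exact: rt_trans ab bc.
Qed.

Lemma rotations_nodes s t : rotations s t -> nodes s = nodes t.
Proof. by elim=> [a b /rotation_nodes|a|a b c _ -> _ ->]. Qed.

(** If no interval of a node left of k reaches k, then k is in no right
    subtree, so it lies on the left spine.  Rotating along that spine makes k
    the root and alters no other entry of the bracket vector. *)
Lemma spine_to_root s k : k < nodes s ->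
  (forall i, i < k -> i + bracket s i < k) ->
  exists a b, [/\ rotations s (Node a b), nodes a = k,
    forall i, i < k -> bracket a i = bracket s i &
    forall i, bracket b i = bracket s (k.+1 + i)].
Proof.
elim: s k => // l IHl r _ k /nodeP[{}k kl sp||{}k kr sp].
- have [i ik|a [b [ab aE av bv]]] := IHl k kl.
    by rewrite -(@bracket_l l r) ?sp //; lia.
  have lE := rotations_nodes ab; rewrite /= in lE.
  exists a, (Node b r); split=> //.
  + apply: rt_trans (rotations_node ab (@rt_refl _ _ r)) _.
    by apply: rt_step; rewrite /= !eqxx.
  + by move=> i ik; rewrite av // bracket_l //; lia.
  + move=> i; rewrite /= bv.
    rewrite (_ : (k.+1 + i < _) = (i < nodes b)); last lia.
    rewrite (_ : (k.+1 + i == _) = (i == nodes b)); last lia.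
    case: ifP => // _; case: ifP => // _.
    by congr bracket; lia.
- move=> _; exists l, r; split=> //; first exact: rt_refl.
  + by move=> i il; rewrite bracket_l.
  + by move=> i; rewrite bracket_r.
- by have := sp (nodes l); rewrite bracket_root; lia.
Qed.

(** The root k of t is on the left spine of s, because the smaller intervals of
    s cannot reach k from the left either.  Once k is the root of both trees,
    the subtrees are compared separately. *)
Lemma bracket_rotations s t : nodes s = nodes t ->
  (forall i, i < nodes t -> bracket s i <= bracket t i) -> rotations s t.
Proof.
elim: t s => [|l IHl r IHr] s st le_st.
  by case: s st le_st => // _ _; exact: rt_refl.
have [|i il|a [b [sab aE av bv]]] := @spine_to_root s (nodes l).
- by rewrite st /=; lia.
- have := le_st i; rewrite bracket_l // => /(_ ltac:(move=> /=; lia)).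
  by have := bracket_lt il; lia.
have := rotations_nodes sab; rewrite st /= => abE.
apply: rt_trans sab (rotations_node (IHl a _ _) (IHr b _ _)) => //; try lia.
- move=> i il; rewrite av // -(@bracket_l l r) //.
  by apply: le_st => /=; lia.
- move=> i ir; rewrite bv -(@bracket_r l r).
  by apply: le_st => /=; lia.
Qed.

Lemma rotations_tamari m (s t : bintree) (hs : nodes s == m) (ht : nodes t == m) :
  rotations s t -> tamari (Tree hs) (Tree ht).
Proof.
move=> st; elim: st hs ht => [a b ab|a|a b c ab IHab _ IHbc] hs ht.
- exact: connect1.
- by rewrite (bool_irrelevance hs ht); exact: connect0.
- have hb : nodes b == m by rewrite -(rotations_nodes ab).
  exact: connect_trans (IHab hs hb) (IHbc hb ht).
Qed.

Lemma nodes_tree m (t : tree m) : nodes t = m.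
Proof. by case: t => t /= /eqP. Qed.

Lemma tamariP m (s t : tree m) :
  reflect (forall i, i < m -> bracket s i <= bracket t i) (s <= t)%O.
Proof.
apply: (iffP idP) => [/connectP[p + ->] i im|].
- elim: p s => //= u p IH s /andP[su up].
  exact: leq_trans (rotation_bracket i su) (IH u up).
- case: s t => [s hs] [t ht] /= le_st; apply: rotations_tamari.
  by apply: bracket_rotations => [|i]; rewrite (eqP ht); [exact: eqP|exact: le_st].
Qed.

(** * The node poset read off the bracket vector *)

(** The node poset computed from a bracket vector: in the second case i is in
    the right subtree of j, in the third one it is in the left subtree. *)
Definition bracket_node_le (v : nat -> nat) (i j : nat) : Prop :=
  [\/ i = j, j < i <= j + v j
    | i < j /\ forall k, i <= k < j -> k + v k < j].

Lemma bracket_node_le_trans m v i j k : is_bracket m v -> k < m ->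
  bracket_node_le v i j -> bracket_node_le v j k -> bracket_node_le v i k.
Proof.
move=> vP km [->//|ij|[ij ijv]] [<-|jk|[jk jkv]].
- exact: Or32.
- by apply: Or32; have [_ /(_ j)] := vP k km; lia.
- apply: Or33; have := jkv j ltac:(lia) => ?; split; first lia.
  by move=> x xi; apply: jkv; lia.
- by apply: Or33.
- have [ki|ik] := ltnP k i; first by apply: Or32; lia.
  by have := ijv k; lia.
- apply: Or33; split=> [|x xk]; first lia.
  by have [xj|jx] := ltnP x j; [have := ijv x | have := jkv x]; lia.
Qed.

Lemma node_le_lt t i j : node_le t i j -> i < nodes t /\ j < nodes t.
Proof.
elim: t i j => //= l IHl r IHr i j.
move=> /or3P[/andP[/eqP-> ->]|/and3P[_ _ /IHl]|/and3P[_ _ /IHr]]; lia.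
Qed.

(** For i < j, the lowest common ancestor k of i and j satisfies i <= k <= j,
    and k < j would put j in the right subtree of k; so j is an ancestor of i
    exactly when no interval starting in [i, j) contains j. *)
Lemma node_leP t i j : i < nodes t -> j < nodes t ->
  node_le t i j <-> bracket_node_le (bracket t) i j.
Proof.
elim: t i j => // l IHl r IHr i j im jm; split.
- move=> /= /or3P[/andP[/eqP jE _]|/and3P[il jl]|/and3P[li lj]].
  + subst j; case/nodeP: im {jm} => [{}i il||{}i ir].
    * apply: Or33; split=> // k /andP[_ kl].
      by rewrite -/(bracket (Node l r) k) bracket_l // bracket_lt.
    * exact: Or31.
    * by apply: Or32; rewrite -/(bracket (Node l r) _) bracket_root; lia.
  + move/(IHl i j il jl) => [->|ij|[ij ijv]]; first exact: Or31.
      by apply: Or32; rewrite jl.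
    apply: Or33; split=> // k kj.
    by rewrite ifT; [exact: ijv | lia].
  + have iE : i = (nodes l).+1 + (i - (nodes l).+1) by lia.
    have jE : j = (nodes l).+1 + (j - (nodes l).+1) by lia.
    rewrite /= in im jm.
    move/(IHr (i - (nodes l).+1) (j - (nodes l).+1) ltac:(lia) ltac:(lia)).
    case=> [ij|ij|[ij ijv]]; first by apply: Or31; lia.
      apply: Or32; rewrite -/(bracket (Node l r) j) jE bracket_r; lia.
    apply: Or33; split=> [|k kj]; first lia.
    rewrite -/(bracket (Node l r) k).
    have -> : k = (nodes l).+1 + (k - (nodes l).+1) by lia.
    by rewrite bracket_r; have := ijv (k - (nodes l).+1); lia.
- case/nodeP: jm im => [{}j jl||{}j jr] im.
  + case/nodeP: im => [{}i il||{}i ir] ij.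
    * rewrite /= il jl (_ : (j == _) = false) /=; last lia.
      rewrite (_ : (_ < i) = false) ?orbF; last lia.
      apply/(IHl i j il jl); case: ij => [->|ij|[ij ijv]]; first exact: Or31.
        by apply: Or32; rewrite -(@bracket_l l r).
      apply: Or33; split=> // k kj.
      by rewrite -(@bracket_l l r) ?ijv //; lia.
    * case: ij => [ij|ij|[ij _]]; try lia.
      by have := bracket_lt jl; rewrite bracket_l // in ij; lia.
    * case: ij => [ij|ij|[ij _]]; try lia.
      by have := bracket_lt jl; rewrite bracket_l // in ij; lia.
  + by move=> _; rewrite /= eqxx; move: im => /= ->.
  + case/nodeP: im => [{}i il||{}i ir] ij.
    * case: ij => [ij|ij|[ij ijv]]; try lia.
      by have := ijv (nodes l); rewrite bracket_root; lia.
    * case: ij => [ij|ij|[ij ijv]]; try lia.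
      by have := ijv (nodes l); rewrite bracket_root; lia.
    * rewrite /= (_ : (_ == _) = false) /=; last lia.
      rewrite (_ : (_ < nodes l) = false) /=; last lia.
      rewrite !addKn; apply/and3P; split; try lia.
      apply/(IHr i j ir jr); case: ij => [ij|ij|[ij ijv]].
      - by apply: Or31; lia.
      - by apply: Or32; rewrite bracket_r in ij; lia.
      - apply: Or33; split=> [|k kj]; first lia.
        by have := ijv ((nodes l).+1 + k); rewrite bracket_r; lia.
Qed.

(** * Painted trees as pairs of a bracket vector and a painted set *)

Definition is_upper (m : nat) (v : nat -> nat) (P : pred nat) : Prop :=
  forall i j, i < m -> j < m -> P i -> bracket_node_le v i j -> P j.

Definition pbracket n (p : painted n) : nat -> nat := bracket (ptree p).

Lemma pbracketP n (p : painted n) : is_bracket n.-1 (pbracket p).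
Proof. by have := @bracketP (ptree p); rewrite nodes_tree. Qed.

Lemma is_painted_lt n (p : painted n) i : is_painted p i -> i < n.-1.
Proof. by case/exists_inP => j _ /eqP <-; exact: ltn_ord. Qed.

Lemma is_painted_ord n (p : painted n) (i : 'I_n.-1) :
  is_painted p i = (i \in pset p).
Proof.
apply/exists_inP/idP => [[j jp /eqP ji]|ip]; last by exists i.
by rewrite -(val_inj ji).
Qed.

Lemma is_painted_upper n (p : painted n) :
  is_upper n.-1 (pbracket p) (is_painted p).
Proof.
move=> i j im jm; rewrite (is_painted_ord p (Ordinal im)).
rewrite (is_painted_ord p (Ordinal jm)) => iP ij.
case: p iP ij => [[t P] /= up] iP ij.
have /forall_inP/(_ _ iP)/forallP/(_ (Ordinal jm))/implyP := up; apply=> /=.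
by apply/node_leP; rewrite ?nodes_tree.
Qed.

Lemma painted_realize n v P : is_bracket n.-1 v -> is_upper n.-1 v P ->
  exists p : painted n, forall i, i < n.-1 ->
    pbracket p i = v i /\ is_painted p i = P i.
Proof.
move=> /bracket_realize[t [tE tv]] up.
have tm : nodes t == n.-1 by apply/eqP.
pose T := Tree tm; pose S := [set i : 'I_n.-1 | P i].
have TS : upper_ideal T S.
  apply/forall_inP => i; rewrite inE => iP; apply/forallP => j.
  have [it jt] : i < nodes T /\ j < nodes T by rewrite tE.
  apply/implyP => /(node_leP it jt) ij; rewrite inE; apply: up iP _ => //.
  case: ij => [->|ij|[ij ijv]]; first exact: Or31.
  - by apply: Or32; rewrite -tv.
  - by apply: Or33; split=> // k kj; rewrite -tv ?ijv //; have := ltn_ord j; lia.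
exists (@Painted n (T, S) TS) => i im; split; first exact: tv.
by rewrite (is_painted_ord _ (Ordinal im)) inE.
Qed.

Lemma painted_leP n (p q : painted n) :
  reflect ((forall i, i < n.-1 -> pbracket p i <= pbracket q i) /\
           forall i, is_painted q i -> is_painted p i) (p <= q)%O.
Proof.
apply: (iffP andP) => -[/tamariP pq QP]; split=> //.
- move=> i qi; have im := is_painted_lt qi; move: qi.
  by rewrite !(is_painted_ord _ (Ordinal im)); apply/subsetP.
- by apply/subsetP => i; rewrite -!is_painted_ord; exact: QP.
Qed.

(** * Painted trees form a lattice *)

(** In a finite poset the join of x and y is the meet of their upper bounds;
    the top serves as the meet of the empty family. *)
Lemma meet_top_lattice d (T : finPOrderType d) :
  (exists t : T, forall x : T, x <= t)%O ->
  (forall x y : T, exists m : T, [/\ m <= x, m <= y &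
     forall z : T, z <= x -> z <= y -> z <= m]%O) ->
  is_lattice T.
Proof.
move=> [t tP] meet x y; split=> //.
have glb (s : seq T) : exists m : T, forall z : T,
    (z <= m)%O <-> {in s, forall u, (z <= u)%O}.
  elim: s => [|u s [m mP]]; first by exists t => z; split=> // _; exact: tP.
  have [w [wu wm wP]] := meet u m; exists w => z; split.
    move=> zw v; rewrite inE => /predU1P[->|vs]; first exact: le_trans wu.
    by apply: (mP z).1 vs; exact: le_trans wm.
  move=> zP; apply: wP; first by apply: zP; rewrite mem_head.
  by apply/mP => v vs; apply: zP; rewrite inE vs orbT.
have [j jP] := glb (enum [pred u : T | (x <= u)%O && (y <= u)%O]).
exists j; split.
- by apply/jP => u; rewrite mem_enum => /andP[].
- by apply/jP => u; rewrite mem_enum => /andP[].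
- by move=> z xz yz; apply: (jP j).1 => //; rewrite mem_enum inE xz.
Qed.

(** The right comb with no painted node has the largest entries possible. *)
Lemma painted_top n : exists t : painted n, forall p : painted n, (p <= t)%O.
Proof.
have [|//|t tP] := @painted_realize n (fun i => n.-1 - i.+1) pred0.
  by move=> i im; split=> [|j ij]; lia.
exists t => p; apply/painted_leP; split=> [i im|i it].
  have [-> _] := tP i im; have [+ _] := pbracketP p im; lia.
by have [_] := tP i (is_painted_lt it); rewrite it.
Qed.

(** The meet has the pointwise minimum v as its vector and the upward closure
    in v of the union of the painted sets as its painted set.  Any lower bound
    paints this closure: left-subtree ancestors for v remain ancestors for
    smaller vectors, and right-subtree ancestors for v are painted already in p
    or in q, whose intervals contain those of v. *)
Lemma painted_meet n (p q : painted n) : exists m : painted n,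
  [/\ m <= p, m <= q & forall z : painted n, z <= p -> z <= q -> z <= m]%O.
Proof.
pose v i := minn (pbracket p i) (pbracket q i).
have vB : is_bracket n.-1 v.
  move=> i im; have [pm pn] := pbracketP p im; have [qm qn] := pbracketP q im.
  split=> [|j ij]; rewrite /v; first lia.
  by have := pn j; have := qn j; rewrite /v in ij; lia.
pose U i := is_painted p i || is_painted q i.
  (* i = j, or i is in the left subtree of j for the vector v: the right
     subtrees never contribute new painted nodes. *)
pose left i j := (i <= j) && all (fun k => k + v k < j) (iota i (j - i)).
have leftP i j : reflect (i = j \/ (i < j /\ forall k, i <= k < j -> k + v k < j))
    (left i j).
  apply: (iffP andP) => [[ij /allP ijv]|[->|[ij ijv]]].
  - case: (ltngtP i j) ij => // [ij _|->]; [right|by left].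
    by split=> // k kj; apply: ijv; rewrite mem_iota; lia.
  - by rewrite leqnn subnn.
  - split; first exact: ltnW.
    by apply/allP => k; rewrite mem_iota => kj; apply: ijv; lia.
pose P j := has (fun i => U i && left i j) (iota 0 n.-1).
have PE j : j < n.-1 -> P j <-> exists2 i, U i & bracket_node_le v i j.
  move=> jm; split=> [/hasP[i _ /andP[iU /leftP ij]]|[i iU ij]].
    by exists i => //; case: ij => [->|]; [exact: Or31|exact: Or33].
  have im : i < n.-1 by case/orP: iU => /is_painted_lt.
  case: ij => [<-|ij|ij].
  - by apply/hasP; exists i; rewrite ?mem_iota ?iU //; apply/leftP; left.
  - apply/hasP; exists j; rewrite ?mem_iota //.
    apply/andP; split; last by apply/leftP; left.
    rewrite /v in ij; case/orP: iU => iU; apply/orP; [left|right].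
      by apply: (is_painted_upper im jm iU); apply: Or32; lia.
    by apply: (is_painted_upper im jm iU); apply: Or32; lia.
  - by apply/hasP; exists i; rewrite ?mem_iota ?iU //; apply/leftP; right.
have PU : is_upper n.-1 v P.
  move=> i j im jm /PE-/(_ im)[k kU ki] ij; apply/PE => //.
  by exists k => //; exact: bracket_node_le_trans vB jm ki ij.
have [m mP] := painted_realize vB PU; exists m.
have mU i : U i -> is_painted m i.
  move=> iU; have im : i < n.-1 by case/orP: iU => /is_painted_lt.
  by have [_ ->] := mP i im; apply/PE => //; exists i => //; exact: Or31.
split.
- apply/painted_leP; split=> [i im|i ip]; last by apply: mU; rewrite /U ip.
  by have [-> _] := mP i im; exact: geq_minl.
- apply/painted_leP; split=> [i im|i iq]; last by apply: mU; rewrite /U iq orbT.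
  by have [-> _] := mP i im; exact: geq_minr.
- move=> z /painted_leP[zp Zp] /painted_leP[zq Zq].
  have zv i : i < n.-1 -> pbracket z i <= v i by move=> im; rewrite leq_min zp ?zq.
  apply/painted_leP; split=> [i im|j mj].
    by have [-> _] := mP i im; exact: zv.
  have jm := is_painted_lt mj; have [_] := mP j jm; rewrite mj => /esym.
  move=> /hasP[i _ /andP[iU /leftP ij]].
  have iz : is_painted z i by case/orP: iU => [/Zp|/Zq].
  apply: (is_painted_upper (is_painted_lt iz) jm iz).
  case: ij => [->|[ij ijv]]; [exact: Or31|apply: Or33; split=> // k kj].
  by have := ijv k kj; have := zv k; lia.
Qed.

Lemma painted_lattice n : is_lattice (painted n).
Proof. exact: meet_top_lattice (painted_top n) (@painted_meet n). Qed.

(** * Grafting right combs *)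

Lemma bracket_right_comb w i : bracket (right_comb w) i = w.-1 - i.+1.
Proof.
case: w => //= w; elim: w i => //= w IH i.
have -> : nodes (iter w (Node Leaf) Leaf) = w by elim: w {IH} => //= w ->.
by case: i => [|i] /=; rewrite ?subn1 ?IH ?subSS //; lia.
Qed.

Definition comb_forest (t : bintree) (P : pred nat) : bintree :=
  comb_graft (portion t P, map leaves (forest t P)).

Lemma size_weights t P : size (map leaves (forest t P)) = leaves (portion t P).
Proof. by rewrite size_map size_forest. Qed.

Lemma weights_gt0 t P : all (fun w => 0 < w) (map leaves (forest t P)).
Proof. by apply/allP => w /mapP[f _ ->]; exact: leaves_gt0. Qed.

Lemma nodes_comb_forest t P : nodes (comb_forest t P) = nodes t.
Proof.
apply: succn_inj; rewrite nodes_comb_graft ?size_weights ?weights_gt0 //.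
by rewrite sumn_leaves_forest leavesE.
Qed.

(** An unpainted right comb ends just before the next painted node or at the
    last node, and each of its intervals extends to its end. *)
Lemma comb_forestP t (P : pred nat) : (forall i j, node_le t i j -> P i -> P j) ->
  forall i, i < nodes t ->
  [/\ (i.+1 \in cuts (map leaves (forest t P))) = P i,
      P i -> bracket (comb_forest t P) i = bracket t i &
      ~~ P i -> (i + bracket (comb_forest t P) i).+1 = nodes t \/
                P (i + bracket (comb_forest t P) i).+1].
Proof.
elim: t P => // l IHl r IHr P up i im.
have [Pk|nPk] := boolP (P (nodes l)); last first.
  have nPi : P i = false.
    apply/negP => Pi; case/negP: nPk; apply: up Pi.
    by move: im; rewrite /= eqxx => ->.
  rewrite /comb_forest /= (negbTE nPk) /= nPi; split=> // _; left.
  by rewrite /comb_graft /= bracket_right_comb !leavesE /= in im *; lia.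
have upl a b : node_le l a b -> P a -> P b.
  move=> ab; apply: up => /=.
  have [al bl] := node_le_lt ab.
  by rewrite al bl ab orbT.
have upr a b : node_le r a b -> P ((nodes l).+1 + a) -> P ((nodes l).+1 + b).
  move=> ab; apply: up => /=; rewrite !addKn ab.
  by apply/or3P; apply: Or33; lia.
have {IHl} := IHl P upl; have {IHr} := IHr (fun i => P ((nodes l).+1 + i)) upr.
have cE : comb_forest (Node l r) P =
    Node (comb_forest l P) (comb_forest r (fun i => P ((nodes l).+1 + i))).
  by rewrite /comb_forest /= Pk map_cat comb_graft_node // size_weights.
have cutsE j : j \in cuts (map leaves (forest (Node l r) P)) =
   [|| j \in cuts (map leaves (forest l P)), j == (nodes l).+1 |
     ((nodes l).+1 < j) && (j - (nodes l).+1 \in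
       cuts (map leaves (forest r (fun i => P ((nodes l).+1 + i)))))].
  rewrite /= Pk map_cat cuts_cat ?weights_gt0 ?sumn_leaves_forest ?leavesE //;
    by rewrite -size_eq0 size_weights leavesE.
rewrite cE cutsE.
have := nodes_comb_forest l P.
have := nodes_comb_forest r (fun i => P ((nodes l).+1 + i)).
set cl := comb_forest l P; set cr := comb_forest r _.
move: cl cr {cE cutsE} => cl cr nr nl IHr IHl.
case/nodeP: im => [{}i il||{}i ir].
- have [a b c] := IHl i il; rewrite a !bracket_l ?nl //.
  have -> : (i.+1 == (nodes l).+1) = false by lia.
  have -> : ((nodes l).+1 < i.+1) = false by lia.
  by rewrite !orbF; split=> // /c[->|]; right.
- rewrite eqxx orbT Pk; split=> // _.
  by rewrite -{1}nl !bracket_root nr.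
- have [a b c] := IHr i ir.
  have -> : bracket (Node cl cr) ((nodes l).+1 + i) = bracket cr i.
    by rewrite -nl bracket_r.
  rewrite bracket_r; set j := (_ + i).+1.
  have -> : (j \in cuts (map leaves (forest l P))) = false.
    apply/negP => /(cuts_lt (weights_gt0 _ _)).
    by rewrite sumn_leaves_forest leavesE; lia.
  have -> : (j == (nodes l).+1) = false by lia.
  have -> : ((nodes l).+1 < j) = true by lia.
  have -> : j - (nodes l).+1 = i.+1 by lia.
  rewrite a; split=> // /c[e|Pi]; [left=> /=|right]; first lia.
  by rewrite -addnA addnS in Pi *.
Qed.

(** * The retraction *)

Section Phi.
Variables (n : nat) (hn : 1 <= n).

Definition combed (p : painted n) : painted n := comb_painted (phi hn p).

Lemma combedP (p : painted n) i : i < n.-1 ->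
  [/\ is_painted (combed p) i = is_painted p i,
      is_painted p i -> pbracket (combed p) i = pbracket p i &
      ~~ is_painted p i -> (i + pbracket (combed p) i).+1 = n.-1 \/
                           is_painted p (i + pbracket (combed p) i).+1].
Proof.
move=> im; have := @comb_forestP (ptree p) (is_painted p).
rewrite nodes_tree => /(_ _ i im)[|a b c].
  move=> x y xy px; have [xm ym] := node_le_lt xy.
  have := (node_leP xm ym).1 xy; rewrite nodes_tree in xm ym.
  exact: is_painted_upper xm ym px.
by split; [rewrite /combed is_painted_comb | exact: b | exact: c].
Qed.

Lemma combed_painted (p : painted n) i :
  is_painted (combed p) i = is_painted p i.
Proof.
have [im|im] := ltnP i n.-1; first by case: (combedP p im).
by apply/idP/idP => /is_painted_lt; lia.
Qed.

(** If the entry of an unpainted node i decreased, its interval in p would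
    contain the painted node that follows its interval in [combed p]; but the
    ancestors of a painted node are painted. *)
Lemma pbracket_combed (p : painted n) i : i < n.-1 ->
  pbracket p i <= pbracket (combed p) i.
Proof.
move=> im; have [_ b c] := combedP p im.
have [/b->//|nPi] := boolP (is_painted p i).
rewrite leqNgt; apply/negP => lt_i.
have [ip _] := pbracketP p im.
have [|Pj] := c nPi; first lia.
case/negP: nPi; apply: is_painted_upper (is_painted_lt Pj) im Pj _.
by apply: Or32; lia.
Qed.

Lemma le_combed (p : painted n) : (p <= combed p)%O.
Proof.
apply/painted_leP; split; first exact: pbracket_combed.
by move=> i; rewrite combed_painted.
Qed.

(** Comparing brackets at the painted nodes suffices: at an unpainted node i of
    p the interval after combing ends before the next painted node, which for q
    is no closer than for p.  This gives both the monotonicity of phi and the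
    description of its fibres. *)
Lemma phi_le (p q : painted n) :
  (forall i, is_painted q i -> is_painted p i) ->
  (forall i, is_painted p i -> pbracket p i <= pbracket q i) ->
  (phi hn p <= phi hn q)%O.
Proof.
move=> QP pq; rewrite -[(_ <= _)%O]/(combed p <= combed q)%O.
apply/painted_leP; split=> [i im|i]; last by rewrite !combed_painted; exact: QP.
have [a b c] := combedP p im.
have [Pi|nPi] := boolP (is_painted p i).
  by rewrite b //; apply: leq_trans (pq i Pi) (pbracket_combed q im).
have nQi : ~~ is_painted q i by apply: contra nPi; exact: QP.
have [_ _ /(_ nQi) cq] := combedP q im.
rewrite leqNgt; apply/negP => lt_i.
have [ip _] := pbracketP (combed p) im.
have [|/QP Pj] := cq; first lia.
rewrite -combed_painted in Pj.
case/negP: nPi; rewrite -combed_painted.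
apply: is_painted_upper (is_painted_lt Pj) im Pj _.
by apply: Or32; lia.
Qed.

Lemma phi_homo : {homo phi hn : p q / (p <= q)%O}.
Proof.
move=> p q /painted_leP[pq QP]; apply: phi_le => // i Pi.
by apply: pq; exact: is_painted_lt Pi.
Qed.

Lemma comb_paintedK : cancel (@comb_painted n) (phi hn).
Proof.
move=> q; apply: val_inj => /=.
by rewrite painted_portion_comb weights_comb -surjective_pairing.
Qed.

Lemma phi_eqP (p q : painted n) :
  phi hn p = phi hn q <->
  is_painted p =1 is_painted q /\
  forall i, is_painted p i -> pbracket p i = pbracket q i.
Proof.
split=> [e|[PQ pq]].
  have cE : combed p = combed q by rewrite /combed e.
  have PQ : is_painted p =1 is_painted q.
    by move=> i; rewrite -combed_painted cE combed_painted.
  split=> // i Pi; have im := is_painted_lt Pi.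
  have [_ <- //] := combedP p im; rewrite cE.
  by have [_ -> //] := combedP q im; rewrite -PQ.
apply/le_anti/andP; split; apply: phi_le => i; rewrite ?PQ //.
  by rewrite -PQ => /pq->.
by rewrite -PQ => /pq->.
Qed.

(** Replacing the unpainted trees by left combs, i.e. emptying the interval of
    each unpainted node, keeps the painted set an upper ideal.  Indeed, suppose
    that an unpainted j became an ancestor of a painted i < j.  In c some
    interval from [i, j) reaches j; its origin k is unpainted, and k itself is
    then an ancestor of i in the new tree, since a painted interval from [i, k)
    containing k would by nesting contain j.  This descent on j terminates. *)
Lemma fibre_bottom (c : painted n) : exists a : painted n,
  is_painted a =1 is_painted c /\ forall i, i < n.-1 ->
    pbracket a i = if is_painted c i then pbracket c i else 0.
Proof.
pose v i := if is_painted c i then pbracket c i else 0.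
have v_le i : v i <= pbracket c i by rewrite /v; case: ifP.
have vB : is_bracket n.-1 v.
  move=> i im; have [cm cn] := pbracketP c im; have := v_le i.
  split=> [|j ij]; first lia.
  have [->|ne] := eqVneq j i; first exact: leqnn.
  have vi : v i = if is_painted c i then pbracket c i else 0 by [].
  move: vi ij; case: ifP => _ -> ij; last lia.
  by have := cn j ij; have := v_le j; lia.
have vU : is_upper n.-1 v (is_painted c).
  move=> i j im jm Pi [<-//|ij|[ij ijv]].
    by move: ij; rewrite /v; case: ifP; lia.
  elim/ltn_ind: j jm ij ijv => j IH jm ij ijv.
  have [/allP jv|/allPn[k]] :=
    boolP (all (fun k => k + pbracket c k < j) (iota i (j - i))).
    apply: is_painted_upper im jm Pi _; apply: Or33; split=> // k kj.
    by apply: jv; rewrite mem_iota; lia.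
  rewrite mem_iota => kj jk.
  have nPk : ~~ is_painted c k.
    by apply/negP => Pk; have := ijv k ltac:(lia); rewrite /v Pk; lia.
  case/negP: (nPk); apply: IH; try lia.
    rewrite ltn_neqAle andbC; apply/andP; split; first lia.
    by apply: contraNneq nPk => <-.
  move=> x xk; have := ijv x ltac:(lia).
  have [_ xn] := pbracketP c (i := x) ltac:(lia).
  by have := xn k; rewrite /v; case: ifP; lia.
have [a aP] := painted_realize vB vU; exists a; split=> i.
  have [im|im] := ltnP i n.-1; first by case: (aP i im).
  by apply/idP/idP => /is_painted_lt; lia.
by move=> im; case: (aP i im).
Qed.

Lemma phi_fibre (q : weighted n) : exists a b : painted n,
  forall x : painted n, phi hn x = q <-> (a <= x <= b)%O.
Proof.
set c := comb_painted q; have [a [aP av]] := fibre_bottom c.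
have cq : phi hn c = q by exact: comb_paintedK.
exists a, c => x; split.
- move=> xq; have cE : combed x = c by rewrite /combed xq.
  rewrite -{1}cE le_combed andbT.
  have /phi_eqP[PX px] : phi hn c = phi hn x by rewrite cq.
  apply/painted_leP; split=> i; last by rewrite aP PX.
  by move=> im; rewrite av //; case: ifP => // /px->.
- move=> /andP[/painted_leP[ax XA] /painted_leP[xc CX]].
  rewrite -cq; apply/phi_eqP; split=> [i|i Xi].
    by apply/idP/idP => [/XA|/CX]; rewrite ?aP.
  have im := is_painted_lt Xi; apply/eqP; rewrite eqn_leq xc //=.
  by have := ax i im; rewrite av // -aP XA.
Qed.

End Phi.

(** The bounds of x and y are the images under f of those of g x and g y. *)
Lemma retract_lattice d d' (P : finPOrderType d) (Q : porderType d')
    (f : P -> Q) (g : Q -> P) :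
  {homo f : x y / x <= y}%O -> {homo g : x y / x <= y}%O -> cancel g f ->
  is_lattice P -> is_lattice Q.
Proof.
move=> fh gh gK L x y; have [[m [mx my mP]] [j [xj yj jP]]] := L (g x) (g y).
split; [exists (f m)|exists (f j)]; split.
- by rewrite -[x]gK; exact: fh.
- by rewrite -[y]gK; exact: fh.
- by move=> z zx zy; rewrite -[z]gK; apply/fh/mP; exact: gh.
- by rewrite -[x]gK; exact: fh.
- by rewrite -[y]gK; exact: fh.
- by move=> z xz yz; rewrite -[z]gK; apply/fh/jP; exact: gh.
Qed.

Theorem theorem3p3 (n : nat) (hn : (1 <= n)%N) :
  is_lattice (weighted n) /\ interval_retract (phi hn).
Proof.
have gh : {homo @comb_painted n : q q' / (q <= q')%O} by move=> q q'.
split.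
  exact: retract_lattice (phi_homo hn) gh (comb_paintedK hn) (@painted_lattice n).
split.
- exact: painted_lattice.
- exact: phi_homo.
- by move=> q; exists (comb_painted q); exact: comb_paintedK.
- exact: phi_fibre.
- by exists (@comb_painted n); split=> //; exact: comb_paintedK.
Qed.
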